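(* Let $n\ge 2$ be an integer. There exists a convex system $\{K_1,\ldots,K_n\}$ in $\mathbb{R}^2$ consisting of $n$ sets that has no ordinary line if and only if $n>3$.
   Context: A convex system in $\mathbb{R}^d$ ($d\ge 2$) is a family $\mathcal F=\{K_1,\ldots,K_n\}$, $n\ge 2$, of pairwise disjoint, compact, strictly convex sets in $\mathbb{R}^d$, each with nonempty interior. Let $U=\bigcup_{i=1}^n K_i$. A line $L$ is called an ordinary line of $\mathcal F$ if $L\cap U$ consists of exactly two points. *)

(* Defs.v *)
From HB Require Import structures.
From mathcomp Require Import all_boot all_order all_algebra.
From mathcomp Require Import all_classical all_reals all_analysis.

Set Implicit Arguments.
Unset Strict Implicit.
Unset Printing Implicit Defensive.

Import Order.TTheory GRing.Theory Num.Theory.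
Import numFieldNormedType.Exports.

Local Open Scope classical_set_scope.
Local Open Scope ring_scope.

Definition strictly_convex (R : realType) (d : nat) (K : set 'rV[R]_d) : Prop :=
  forall (x y : 'rV[R]_d) (t : R), K x -> K y -> x != y -> 0 < t < 1 ->
    interior K ((1 - t) *: x + t *: y).

(* The topology on ['rV[R]_d] is the product topology, so [compact] and
   [interior] have their usual Euclidean meaning. The members are nonempty and
   pairwise disjoint, hence distinct: the indexed family is a set of exactly
   [n] bodies. *)
Definition convex_system (R : realType) (d n : nat)
    (K : 'I_n -> set 'rV[R]_d) : Prop :=
  [/\ (2 <= d)%N /\ (2 <= n)%N,
      trivIset setT K,
      forall i, compact (K i),
      forall i, strictly_convex (K i) &
      forall i, interior (K i) !=set0].

Definition is_line (R : realType) (d : nat) (L : set 'rV[R]_d) : Prop :=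
  exists (p v : 'rV[R]_d), v != 0 /\ L = [set p + t *: v | t in [set: R]].

Definition ordinary_line (R : realType) (d n : nat)
    (K : 'I_n -> set 'rV[R]_d) (L : set 'rV[R]_d) : Prop :=
  is_line L /\
  exists (p q : 'rV[R]_d), p != q /\ L `&` \bigcup_i K i = [set p; q].

(* Main.v *)
Require Import Defs.
From mathcomp Require Import all_boot all_order all_algebra.
From mathcomp Require Import all_classical all_reals all_analysis.
From mathcomp Require Import ring lra.

(* A line is ordinary exactly when it is tangent to two bodies and misses the
   others. For two bodies take a direction where the support functions agree.
   For three bodies, a body A extreme in some direction ties for the extreme in
   two different directions, one on each arc of directions between one where
   only A is extreme and one where it is not (if every direction is a tie, take
   two opposite ones). If some tie involves only two bodies we are done;
   otherwise all three bodies touch two common supporting lines. Being disjoint,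
   they touch both with the same body in the middle, and then a line separating
   this body from one of the others and tangent to both misses the third.
   For four bodies, take tall ellipses A, C at the left and right, flat ellipses
   B, D at the top and bottom, all inscribed in the strip |y| <= 1 with A and C
   poking slightly between B and D. No line separates them, so a line crossing
   no body supports all four; it touches only A, only C, or three of them.
   Further bodies are small discs near the centre, out of reach of such lines. *)

Set Implicit Arguments.
Unset Strict Implicit.
Unset Printing Implicit Defensive.

Import Order.TTheory GRing.Theory Num.Theory.
Import numFieldNormedType.Exports.

Local Open Scope classical_set_scope.
Local Open Scope ring_scope.

(** * Linear functionals and lines in the plane *)

Definition dot (R : realType) (u x : 'rV[R]_2) : R :=
  u 0 0 * x 0 0 + u 0 1 * x 0 1.

Definition perp (R : realType) (u : 'rV[R]_2) : 'rV[R]_2 :=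
  \row_i (if i == 0 then - u 0 1 else u 0 0).

Definition det (R : realType) (u v : 'rV[R]_2) : R :=
  u 0 0 * v 0 1 - u 0 1 * v 0 0.

Lemma row2P (R : realType) (x y : 'rV[R]_2) :
  x 0 0 = y 0 0 -> x 0 1 = y 0 1 -> x = y.
Proof.
move=> h0 h1; apply/rowP => -[[|[|//]] ik].
  by rewrite (_ : Ordinal ik = 0)//; exact/val_inj.
by rewrite (_ : Ordinal ik = 1)//; exact/val_inj.
Qed.

Lemma perp0 (R : realType) (u : 'rV[R]_2) : perp u 0 0 = - u 0 1.
Proof. by rewrite mxE. Qed.

Lemma perp1 (R : realType) (u : 'rV[R]_2) : perp u 0 1 = u 0 0.
Proof. by rewrite mxE. Qed.

Lemma dotuu_gt0 (R : realType) (u : 'rV[R]_2) : u != 0 -> 0 < dot u u.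
Proof.
move=> u0; rewrite /dot lt_neqAle addr_ge0 ?sqr_ge0// andbT eq_sym.
apply: contra u0; rewrite paddr_eq0 ?sqr_ge0// !mulf_eq0 !orbb.
by move=> /andP[/eqP u00 /eqP u01]; apply/eqP/row2P; rewrite mxE.
Qed.

(** [u] and [perp u] form an orthogonal basis, so these two products determine both coordinates. *)
Lemma dot_inj (R : realType) (u x y : 'rV[R]_2) : u != 0 ->
  dot u x = dot u y -> dot (perp u) x = dot (perp u) y -> x = y.
Proof.
move=> /dotuu_gt0; rewrite /dot perp0 perp1 => u0 h1 h2.
have n0 : u 0 0 * u 0 0 + u 0 1 * u 0 1 != 0 by exact: lt0r_neq0.
have e0 z : (u 0 0 * u 0 0 + u 0 1 * u 0 1) * z 0 0 =
    u 0 0 * (u 0 0 * z 0 0 + u 0 1 * z 0 1)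
    - u 0 1 * (- u 0 1 * z 0 0 + u 0 0 * z 0 1) by ring.
have e1 z : (u 0 0 * u 0 0 + u 0 1 * u 0 1) * z 0 1 =
    u 0 1 * (u 0 0 * z 0 0 + u 0 1 * z 0 1)
    + u 0 0 * (- u 0 1 * z 0 0 + u 0 0 * z 0 1) by ring.
by apply: row2P; apply: (mulfI n0); rewrite ?e0 ?e1 h1 h2.
Qed.

Lemma dotDr (R : realType) (u x y : 'rV[R]_2) : dot u (x + y) = dot u x + dot u y.
Proof. by rewrite /dot !mxE; ring. Qed.

Lemma dotDl (R : realType) (u v x : 'rV[R]_2) : dot (u + v) x = dot u x + dot v x.
Proof. by rewrite /dot !mxE; ring. Qed.

Lemma dotZr (R : realType) (u x : 'rV[R]_2) k : dot u (k *: x) = k * dot u x.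
Proof. by rewrite /dot !mxE; ring. Qed.

Lemma dotZl (R : realType) (u x : 'rV[R]_2) k : dot (k *: u) x = k * dot u x.
Proof. by rewrite /dot !mxE; ring. Qed.

Lemma dotNl (R : realType) (u x : 'rV[R]_2) : dot (- u) x = - dot u x.
Proof. by rewrite /dot !mxE; ring. Qed.

Lemma dotNr (R : realType) (u x : 'rV[R]_2) : dot u (- x) = - dot u x.
Proof. by rewrite /dot !mxE; ring. Qed.

Definition dotE := (dotDr, dotDl, dotZr, dotZl, dotNl, dotNr).

Lemma dot_perp (R : realType) (u : 'rV[R]_2) : dot u (perp u) = 0.
Proof. by rewrite /dot perp0 perp1; ring. Qed.

Lemma perp_dot (R : realType) (u : 'rV[R]_2) : dot (perp u) u = 0.
Proof. by rewrite /dot perp0 perp1; ring. Qed.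

Lemma dot_continuous (R : realType) (u : 'rV[R]_2) : continuous (dot u).
Proof.
have cM (i : 'I_2) (c : R) : continuous (fun x : 'rV[R]_2 => c * x 0 i : R).
  move=> x; apply: (@continuous_comp _ _ _ (fun x : 'rV[R]_2 => x 0 i) ( *%R c)).
    exact: coord_continuous.
  exact: mulrl_continuous.
by move=> x; exact: (continuousD (cM 0 (u 0 0) x) (cM 1 (u 0 1) x)).
Qed.

Lemma affine_line_level (R : realType) (w p v : 'rV[R]_2) :
  w != 0 -> v != 0 -> dot w v = 0 ->
  [set p + t *: v | t in [set: R]] = [set x | dot w x = dot w p].
Proof.
move=> w0 v0 wv; apply/seteqP; split=> [x /= [t _ <-]|x /= h].
  by rewrite !dotE wv mulr0 addr0.
have vv := dotuu_gt0 v0; have vv0 := lt0r_neq0 vv.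
exists (dot v (x - p) / dot v v) => //.
apply/(dot_inj v0).
  by rewrite dotDr dotZr mulfVK// dotDr dotNr addrC subrK.
have -> : dot (perp v) (p + dot v (x - p) / dot v v *: v) = dot (perp v) p.
  by rewrite !dotE perp_dot mulr0 addr0.
have ww := dotuu_gt0 w0; have ww0 := lt0r_neq0 ww.
apply: (mulfI ww0); apply/eqP; rewrite -subr_eq0; apply/eqP.
(* [perp v] is expanded in the orthogonal basis [w], [perp w]; both terms vanish. *)
transitivity (dot (perp w) v * (dot w x - dot w p)
              - dot w v * (dot (perp w) x - dot (perp w) p)).
  by rewrite /dot !perp0 !perp1; ring.
by rewrite wv h subrr; ring.
Qed.

Lemma perp_neq0 (R : realType) (u : 'rV[R]_2) : u != 0 -> perp u != 0.
Proof.
move=> u0; apply: contra u0 => /eqP pu; apply/eqP/row2P; rewrite mxE.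
  by rewrite -perp1 pu mxE.
by apply: oppr_inj; rewrite -perp0 pu mxE oppr0.
Qed.

Lemma level_set_is_line (R : realType) (w : 'rV[R]_2) (c : R) :
  w != 0 -> is_line [set x | dot w x = c].
Proof.
move=> w0; have ww := lt0r_neq0 (dotuu_gt0 w0).
(* The base point is the foot of the perpendicular from the origin. *)
exists ((c / dot w w) *: w), (perp w); split; first exact: perp_neq0.
by rewrite (@affine_line_level _ w) ?dot_perp ?perp_neq0// dotZr divfK.
Qed.

Lemma is_line_level_set (R : realType) (L : set 'rV[R]_2) : is_line L ->
  exists w c, w != 0 /\ L = [set x | dot w x = c].
Proof.
move=> [p [v [v0 ->]]]; exists (perp v), (dot (perp v) p).
by split; [exact: perp_neq0|rewrite (affine_line_level _ (perp_neq0 v0))// perp_dot].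
Qed.

(** * Supporting lines *)

(** The support function, on directions of any length; hence positively homogeneous on nonempty
    compact sets. *)
Definition supp (R : realType) (K : set 'rV[R]_2) (u : 'rV[R]_2) : R :=
  sup [set dot u x | x in K].

Lemma supp_has_max (R : realType) (K : set 'rV[R]_2) (u : 'rV[R]_2) :
  compact K -> K !=set0 ->
  (forall x, K x -> dot u x <= supp K u) /\ exists2 x, K x & dot u x = supp K u.
Proof.
move=> cK K0.
have [c cK' cmax] := compact_EVT_max K0 cK (continuous_subspaceT (@dot_continuous _ u)).
rewrite inE in cK'.
have -> : supp K u = dot u c.
  apply/eqP; rewrite eq_le; apply/andP; split.
    apply: ge_sup; first by exists (dot u c), c.
    by move=> _ [x Kx <-]; apply: cmax; rewrite inE.
  apply: ub_le_sup; last by exists c.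
  by exists (dot u c) => _ [x Kx <-]; apply: cmax; rewrite inE.
by split => [x Kx|]; [apply: cmax; rewrite inE|exists c].
Qed.

Lemma supp_ub (R : realType) (K : set 'rV[R]_2) (u x : 'rV[R]_2) :
  compact K -> K x -> dot u x <= supp K u.
Proof. by move=> cK Kx; have [+ _] := supp_has_max u cK (ex_intro _ x Kx); exact. Qed.

Lemma supp_attained (R : realType) (K : set 'rV[R]_2) (u : 'rV[R]_2) :
  compact K -> K !=set0 -> exists2 x, K x & dot u x = supp K u.
Proof. by move=> cK K0; have [] := supp_has_max u cK K0. Qed.

Lemma suppZ (R : realType) (K : set 'rV[R]_2) (u : 'rV[R]_2) (k : R) :
  compact K -> K !=set0 -> 0 <= k -> supp K (k *: u) = k * supp K u.
Proof.
move=> cK K0 k0; apply/eqP; rewrite eq_le; apply/andP; split.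
  have [x Kx <-] := supp_attained (k *: u) cK K0.
  by rewrite dotZl ler_wpM2l// supp_ub.
have [x Kx <-] := supp_attained u cK K0.
by rewrite -dotZl supp_ub.
Qed.

Lemma compact_coord_bound (R : realType) (K : set 'rV[R]_2) : compact K ->
  exists2 M, 0 <= M & forall x i, K x -> `|x 0 i| <= M.
Proof.
move=> cK; have [K0|K0] := pselect (K !=set0); last first.
  by exists 0 => // x i Kx; case: K0; exists x.
have B (i : 'I_2) : exists M, forall x, K x -> `|x 0 i| <= M.
  have ci : continuous (fun x : 'rV[R]_2 => `|x 0 i| : R).
    move=> x; apply: (@continuous_comp _ _ _ (fun x : 'rV[R]_2 => x 0 i) Num.norm).
      exact: coord_continuous.
    exact: norm_continuous.
  have [c _ cM] := compact_EVT_max K0 cK (continuous_subspaceT ci).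
  by exists `|c 0 i| => x Kx; apply: cM; rewrite inE.
have [M0 HM0] := B 0; have [M1 HM1] := B 1.
have [x Kx] := K0.
have M00 : 0 <= M0 by apply: le_trans (HM0 x Kx).
have M10 : 0 <= M1 by apply: le_trans (HM1 x Kx).
exists (M0 + M1); first exact: addr_ge0.
move=> y [[|[|//]] ik] Ky.
  by rewrite (_ : Ordinal ik = 0) ?ler_wpDr ?HM0//; exact/val_inj.
by rewrite (_ : Ordinal ik = 1) ?ler_wpDl ?HM1//; exact/val_inj.
Qed.

(** A maximiser for [v] tests the value at [w], so the support function is Lipschitz, with a bound
    on the coordinates of [K] as constant. *)
Lemma supp_continuous (R : realType) (K : set 'rV[R]_2) :
  compact K -> K !=set0 -> continuous (supp K).
Proof.
move=> cK K0 u; have [M M0 HM] := compact_coord_bound cK.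
have le v w : supp K v - supp K w <= M * (`|v 0 0 - w 0 0| + `|v 0 1 - w 0 1|).
  have [x Kx <-] := supp_attained v cK K0.
  apply: (@le_trans _ _ (dot v x - dot w x)); first by rewrite lerB// supp_ub.
  have -> : dot v x - dot w x = (v 0 0 - w 0 0) * x 0 0 + (v 0 1 - w 0 1) * x 0 1.
    by rewrite /dot; ring.
  by rewrite mulrDr lerD// (le_trans (ler_norm _))// normrM mulrC ler_wpM2r// HM.
have lip v : `|supp K u - supp K v| <= M * (`|u 0 0 - v 0 0| + `|u 0 1 - v 0 1|).
  rewrite ler_norml le//= andbT lerNl opprB (le_trans (le v u))//.
  by rewrite (distrC (v 0 0)) (distrC (v 0 1)).
apply/(@cvgrPdist_le _ _ _ (nbhs u) (nbhs_filter u)) => e e0.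
(* [M + 1] replaces [M], which may be zero. *)
have e'0 : 0 < e / (2 * (M + 1)) by rewrite divr_gt0// mulr_gt0// ltr_wpDl.
have c (i : 'I_2) : nbhs u [set v : 'rV[R]_2 | `|u 0 i - v 0 i| <= e / (2 * (M + 1))].
  by have /(@cvgrPdist_le _ _ _ (nbhs u) (nbhs_filter u)) := @coord_continuous R 1 2 0 i u; exact.
apply: (@filterS2 _ (nbhs u) (nbhs_filter u) _ _ _ _ (c 0) (c 1)) => v v0 v1.
apply: (le_trans (lip v)).
apply: (@le_trans _ _ (M * (e / (2 * (M + 1)) + e / (2 * (M + 1))))).
  by rewrite ler_wpM2l// lerD.
have -> : M * (e / (2 * (M + 1)) + e / (2 * (M + 1))) = e * (M / (M + 1)).
  by field; rewrite lt0r_neq0// ltr_wpDl.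
rewrite ler_piMr ?(ltW e0)// ler_pdivrMr ?ltr_wpDl// mul1r.
by rewrite lerDl.
Qed.

(** * Strictly convex bodies and their separation *)

Definition body (R : realType) (K : set 'rV[R]_2) : Prop :=
  [/\ compact K, strictly_convex K & interior K !=set0].

Lemma body_nonempty (R : realType) (K : set 'rV[R]_2) : body K -> K !=set0.
Proof. by move=> [_ _ [x /interior_subset]]; exists x. Qed.

Lemma interior_shift (R : realType) (K : set 'rV[R]_2) (u x : 'rV[R]_2) :
  interior K x -> exists2 t : R, 0 < t & K (x + t *: u).
Proof.
move=> xK.
have cl : (fun t : R => x + t *: u) @ (0 : R) --> x + (0 : R) *: u.
  by apply: cvgD; [exact: cvg_cst|apply: cvgZr_tmp; exact: cvg_id].
rewrite scale0r addr0 in cl.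
have nK : \forall t \near (0 : R)^'+, K (x + t *: u).
  by apply: (@cvg_at_right_filter _ _ _ _ _ cl).
have [t [Kt t0]] := filter_ex (filterI nK (nbhs_right_gt 0)).
by exists t.
Qed.

Lemma interior_climb (R : realType) (K : set 'rV[R]_2) (u x : 'rV[R]_2) :
  u != 0 -> interior K x -> exists2 y, K y & dot u x < dot u y.
Proof.
move=> u0 /(@interior_shift _ _ u)[t t0 Kt].
by exists (x + t *: u) => //; rewrite dotDr dotZr ltrDl mulr_gt0// dotuu_gt0.
Qed.

(** The midpoint of two distinct maximisers would be interior, and from an interior point [dot u]
    can still grow. *)
Lemma strictly_convex_max_uniq (R : realType) (K : set 'rV[R]_2) (u x y : 'rV[R]_2) :
  compact K -> strictly_convex K -> u != 0 -> K x -> K y ->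
  dot u x = supp K u -> dot u y = supp K u -> x = y.
Proof.
move=> cK sK u0 Kx Ky ux uy; apply/eqP/negPn/negP => xy.
have h : 0 < (2^-1 : R) < 1 by apply/andP; split; lra.
have [z Kz] := interior_climb u0 (sK x y _ Kx Ky xy h).
by rewrite dotDr !dotZr ux uy -mulrDl subrK mul1r ltNge supp_ub.
Qed.

Lemma body_below (R : realType) (K : set 'rV[R]_2) (u : 'rV[R]_2) :
  body K -> u != 0 -> exists2 x, K x & dot u x < supp K u.
Proof.
move=> [cK _ [x xK]] u0; exists x; first exact: interior_subset.
have [y Ky xy] := interior_climb u0 xK.
by rewrite (lt_le_trans xy)// supp_ub.
Qed.

Lemma strictly_convex_conv (R : realType) (K : set 'rV[R]_2) (x y : 'rV[R]_2) (t : R) :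
  strictly_convex K -> K x -> K y -> 0 <= t <= 1 -> K ((1 - t) *: x + t *: y).
Proof.
move=> sK Kx Ky /andP[t0 t1]; have [<-|xy] := eqVneq x y.
  by rewrite -scalerDl subrK scale1r.
have [<-|tn0] := eqVneq 0 t; first by rewrite subr0 scale1r scale0r addr0.
have [->|tn1] := eqVneq t 1; first by rewrite subrr scale1r scale0r add0r.
apply: interior_subset; apply: sK => //.
by rewrite !lt_neqAle tn0 t0 tn1.
Qed.

(** If some [a] lay beyond the level of [x], a small move from [x] towards [a] would come closer to
    [y]. *)
Lemma nearest_point_supports (R : realType) (K : set 'rV[R]_2) (x y : 'rV[R]_2) :
  strictly_convex K -> K x ->
  (forall z, K z -> dot (y - x) (y - x) <= dot (y - z) (y - z)) ->
  forall a, K a -> dot (y - x) a <= dot (y - x) x.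
Proof.
move=> sK Kx xmin a Ka; rewrite leNgt; apply/negP => xa.
set e := dot (y - x) a - dot (y - x) x.
set d := dot (a - x) (a - x).
have e0 : 0 < e by rewrite subr_gt0.
have d0 : 0 <= d by rewrite /d /dot -!expr2 addr_ge0 ?sqr_ge0.
have ed : 0 < 2 * e + d by lra.
(* Moving by [t] changes the squared distance by [- 2 * t * e + t * (t * d)]. This [t] gives
   [t * d < e], and the summand [2 * e] keeps [t < 1]. *)
set t := e / (2 * e + d).
have te : t * (2 * e + d) = e by rewrite divfK ?lt0r_neq0.
have t0 : 0 < t by rewrite divr_gt0.
have t1 : t < 1 by rewrite ltr_pdivrMr//; lra.
have t01 : 0 <= t <= 1 by rewrite !ltW.
have := xmin _ (strictly_convex_conv sK Kx Ka t01).
have -> : dot (y - ((1 - t) *: x + t *: a)) (y - ((1 - t) *: x + t *: a)) =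
  dot (y - x) (y - x) - 2 * t * e + t * (t * d).
  by rewrite /e /d /dot !mxE; ring.
nra.
Qed.

(** Since [- supp B (- u)] is the minimum of [dot u] on [B], the conclusion is strict separation.
    The direction joins a nearest pair of points, which exists by compactness of [A] and [B]. *)
Lemma body_separation (R : realType) (A B : set 'rV[R]_2) :
  body A -> body B -> A `&` B = set0 ->
  exists2 u, u != 0 & supp A u + supp B (- u) < 0.
Proof.
move=> bA bB AB.
have [cA sA _] := bA; have [cB sB _] := bB.
have [a0 Aa0] := body_nonempty bA; have [b0 Bb0] := body_nonempty bB.
have cf : continuous (fun p : 'rV[R]_2 * 'rV[R]_2 => dot (p.2 - p.1) (p.2 - p.1)).
  have cD : continuous (fun p : 'rV[R]_2 * 'rV[R]_2 => p.2 - p.1).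
    by move=> p; apply: cvgB; [exact: cvg_snd|exact: cvg_fst].
  have cS (i : 'I_2) : continuous (fun v : 'rV[R]_2 => v 0 i * v 0 i : R).
    move=> v; exact: (continuousM (@coord_continuous _ _ _ 0 i v)
      (@coord_continuous _ _ _ 0 i v)).
  have cd : continuous (fun v : 'rV[R]_2 => dot v v).
    by move=> v; exact: (continuousD (cS 0 v) (cS 1 v)).
  by move=> p; exact: (continuous_comp (cD p) (cd _)).
have AB0 : (A `*` B) !=set0 by exists (a0, b0).
have [[x y]] := compact_EVT_min AB0 (compact_setX cA cB) (continuous_subspaceT cf).
rewrite inE => -[/= Ax By] xymin.
have yx0 : y - x != 0.
  rewrite subr_eq0; apply: contra_eq_neq AB => yx.
  by apply/set0P; exists x; split => //; rewrite -yx.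
exists (y - x) => //.
have [a Aa <-] := supp_attained (y - x) cA (body_nonempty bA).
have [b Bb <-] := supp_attained (- (y - x)) cB (body_nonempty bB).
have ax : dot (y - x) a <= dot (y - x) x.
  apply: (nearest_point_supports sA Ax) => // z Az.
  by apply: (xymin (z, y)); rewrite inE.
have yb : dot (x - y) b <= dot (x - y) y.
  apply: (nearest_point_supports sB By) => // z Bz.
  have -> : x - y = - (y - x) by rewrite opprB.
  have -> : x - z = - (z - x) by rewrite opprB.
  rewrite !dotNl !dotNr !opprK.
  by apply: (xymin (x, z)); rewrite inE.
have := dotuu_gt0 yx0; move: ax yb; rewrite !dotE; lra.
Qed.

(* When [v = - u], a detour [w] transverse to [u] keeps the path away from [0]. *)
Definition arc (R : realType) (u v w : 'rV[R]_2) (t : R) : 'rV[R]_2 :=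
  (1 - t) *: u + t *: v + (t * (1 - t)) *: w.

Lemma arc_continuous (R : realType) (u v w : 'rV[R]_2) : continuous (arc u v w).
Proof.
have c1 (x : 'rV[R]_2) (g : R -> R) : continuous g -> continuous (fun t => g t *: x).
  by move=> cg t; apply: cvgZr_tmp; exact: cg.
have cid : continuous (fun t : R => t) by move=> t; exact: cvg_id.
have c1t : continuous (fun t : R => 1 - t).
  by move=> t; apply: cvgB; [exact: cvg_cst|exact: cvg_id].
have cc : continuous (fun t : R => t * (1 - t)).
  by move=> t; exact: (continuousM (cid t) (c1t t)).
move=> t; exact: (continuousD (continuousD (c1 u _ c1t t) (c1 v _ cid t))
  (c1 w _ cc t)).
Qed.

Lemma arc_zero (R : realType) (f : 'rV[R]_2 -> R) (u v w : 'rV[R]_2) :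
  continuous f -> 0 <= f u -> f v <= 0 ->
  exists t, 0 <= t <= 1 /\ f (arc u v w t) = 0.
Proof.
move=> cf fu fv.
have cfa : {within `[0, 1], continuous (f \o arc u v w)}.
  apply: continuous_subspaceT => t; apply: continuous_comp; last exact: cf.
  exact: arc_continuous.
have [|t] := @IVT R (f \o arc u v w) 0 1 0 ler01 cfa.
  rewrite /arc /= !subr0 subrr !(mulr0, mul0r, scale0r, scale1r, addr0, add0r).
  by rewrite ge_min le_max fu fv orbT.
by rewrite in_itv /= => t01 ft; exists t.
Qed.

(** * Two and three bodies *)

Lemma dot_decomp (R : realType) (v w d : 'rV[R]_2) :
  dot v v * dot w d = dot w v * dot v d + dot w (perp v) * dot (perp v) d.
Proof. by rewrite /dot !perp0 !perp1; ring. Qed.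

(** Cramer's rule: [d] is recovered from its products with [u] and [v], then paired with [w]. *)
Lemma dot_cramer (R : realType) (u v w d : 'rV[R]_2) :
  det u v * dot w d = dot v d * dot w (perp u) - dot u d * dot w (perp v).
Proof. by rewrite /dot /det !perp0 !perp1; ring. Qed.

Lemma det0_parallel (R : realType) (u v : 'rV[R]_2) : u != 0 -> det u v = 0 ->
  v = (dot u v / dot u u) *: u.
Proof.
move=> u0 uv; apply/(dot_inj u0); first by rewrite dotZr divfK ?lt0r_neq0 ?dotuu_gt0.
rewrite dotZr perp_dot mulr0 -[RHS]uv /dot /det perp0 perp1; ring.
Qed.

(** The zeros of [f] form rays, and the last conjunct says that the two found are distinct: if
    parallel, they are opposite. They come from the intermediate value theorem on two arcs of
    directions. *)
Lemma two_zeros (R : realType) (f : 'rV[R]_2 -> R) (u u' : 'rV[R]_2) :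
  continuous f -> (forall k v, 0 <= k -> f (k *: v) = k * f v) ->
  0 < f u -> f u' < 0 ->
  exists v1 v2, [/\ v1 != 0, v2 != 0, f v1 = 0, f v2 = 0 &
    (det v1 v2 = 0 -> dot v1 v2 <= 0)].
Proof.
move=> cf fZ fu fu'.
have f0 : f 0 = 0 by rewrite -(scale0r 0) fZ// mul0r.
have u0 : u != 0 by apply: contraTneq fu => ->; rewrite f0 ltxx.
have uu := dotuu_gt0 u0.
(* If [f (- u) < 0], the two arcs run from [u] to [- u], one on each side of the line spanned by
   [u]. *)
have [fNu|fNu] := ltP (f (- u)) 0.
  have half w : exists t, [/\ 0 < t, t < 1 & f (arc u (- u) w t) = 0].
    have [t [/andP[t0 t1] ft]] := arc_zero w cf (ltW fu) (ltW fNu).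
    exists t; split => //; rewrite lt_neqAle ?t0 ?t1 andbT.
      apply: contraTneq fu => t0'; rewrite -leNgt -ft -t0' /arc.
      by rewrite !(subr0, mul0r, scale0r, scale1r, addr0).
    apply: contraTneq fNu => t1'; rewrite -leNgt -ft t1' /arc.
    by rewrite !(subrr, mulr0, scale0r, scale1r, addr0, add0r).
  have [t [t0 t1 ft]] := half (perp u).
  have [s [s0 s1 fs]] := half (- perp u).
  have tt : 0 < t * (1 - t) by rewrite mulr_gt0// subr_gt0.
  have ss : 0 < s * (1 - s) by rewrite mulr_gt0// subr_gt0.
  exists (arc u (- u) (perp u) t), (arc u (- u) (- perp u) s); split => //.
  - apply: contraTneq tt => h.
    have : dot (perp u) (arc u (- u) (perp u) t) = 0 by rewrite h /dot !mxE; ring.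
    have -> : dot (perp u) (arc u (- u) (perp u) t) = t * (1 - t) * dot u u.
      by rewrite /dot /arc !mxE /=; ring.
    by move=> /eqP; rewrite mulf_eq0 (gt_eqF uu) orbF => /eqP ->; rewrite ltxx.
  - apply: contraTneq ss => h.
    have : dot (perp u) (arc u (- u) (- perp u) s) = 0 by rewrite h /dot !mxE; ring.
    have -> : dot (perp u) (arc u (- u) (- perp u) s) = - (s * (1 - s)) * dot u u.
      by rewrite /dot /arc !mxE /=; ring.
    by move=> /eqP; rewrite mulf_eq0 (gt_eqF uu) orbF oppr_eq0 => /eqP ->; rewrite ltxx.
  - have -> : det (arc u (- u) (perp u) t) (arc u (- u) (- perp u) s) =
      - ((1 - 2 * t) * (s * (1 - s)) + (1 - 2 * s) * (t * (1 - t))) * dot u u.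
      by rewrite /det /dot /arc !mxE /=; ring.
    have -> : dot (arc u (- u) (perp u) t) (arc u (- u) (- perp u) s) =
      ((1 - 2 * t) * (1 - 2 * s) - (t * (1 - t)) * (s * (1 - s))) * dot u u.
      by rewrite /dot /arc !mxE /=; ring.
    move=> /eqP; rewrite mulf_eq0 (gt_eqF uu) orbF oppr_eq0 => /eqP h.
    (* After multiplication by [t * (1 - t) > 0], [h] eliminates [1 - 2 * s] and leaves minus a sum
       of nonnegative terms. *)
    rewrite pmulr_lle0// -(pmulr_rle0 _ tt).
    have -> : t * (1 - t) * ((1 - 2 * t) * (1 - 2 * s) - t * (1 - t) * (s * (1 - s))) =
      - ((1 - 2 * t) * (1 - 2 * t) * (s * (1 - s)) +
         t * (1 - t) * (t * (1 - t)) * (s * (1 - s))).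
      move: h; set T := t * (1 - t); set S := s * (1 - s).
      move=> /eqP; rewrite addrC addr_eq0 => /eqP h.
      transitivity ((1 - 2 * t) * ((1 - 2 * s) * T) - T * T * S); first by ring.
      by rewrite h; ring.
    rewrite oppr_le0 addr_ge0// mulr_ge0 ?(ltW ss)//; first by rewrite -expr2 sqr_ge0.
    by rewrite -expr2 sqr_ge0.
(* Now [f] is nonnegative at [u] and at [- u], hence on the whole line they span, which therefore
   misses [u']. *)
have du : det u u' != 0.
  apply/negP => /eqP /(det0_parallel u0) e.
  have [k0|k0] := leP 0 (dot u u' / dot u u).
    by move: fu'; rewrite e fZ// ltNge mulr_ge0// ltW.
  move: fu'; rewrite e -(opprK (dot u u' / dot u u)) scaleNr -scalerN fZ.
    by rewrite ltNge mulr_ge0// oppr_ge0 ltW.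
  by rewrite oppr_ge0 ltW.
(* Straight segments from [u] and from [- u] to [u'] suffice. Possibly [s = 0], but
   [t * (1 - s) > 0] still makes the zeros independent. *)
have [t [/andP[t0 t1] ft]] := arc_zero 0 cf (ltW fu) (ltW fu').
have [s [/andP[s0 s1] fs]] := arc_zero 0 cf fNu (ltW fu').
have {}t0 : 0 < t.
  rewrite lt_neqAle t0 andbT; apply: contraTneq fu => t0'.
  by rewrite -leNgt -ft -t0' /arc !(subr0, mul0r, scale0r, scale1r, addr0).
have {}t1 : t < 1.
  rewrite lt_neqAle t1 andbT; apply: contraTneq fu' => t1'.
  by rewrite -leNgt -ft t1' /arc !(subrr, mulr0, scale0r, scale1r, addr0, add0r).
have {}s1 : s < 1.
  rewrite lt_neqAle s1 andbT; apply: contraTneq fu' => s1'.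
  by rewrite -leNgt -fs s1' /arc !(subrr, mulr0, scale0r, scale1r, addr0, add0r).
have d0 : det (arc u u' 0 t) (arc (- u) u' 0 s) != 0.
  have -> : det (arc u u' 0 t) (arc (- u) u' 0 s) =
    ((1 - t) * s + t * (1 - s)) * det u u'.
    by rewrite /det /arc !mxE; ring.
  by rewrite mulf_neq0// lt0r_neq0//; nra.
exists (arc u u' 0 t), (arc (- u) u' 0 s); split => //.
- by apply: contra_neq d0 => ->; rewrite /det !mxE; ring.
- by apply: contra_neq d0 => ->; rewrite /det !mxE; ring.
- by move=> d00; rewrite d00 eqxx in d0.
Qed.

(** * Order of the contact points along supporting lines *)

(** Here [b - a] is a positive multiple of [perp v]. *)
Lemma slope_gt0 (R : realType) (v w a b : 'rV[R]_2) : v != 0 ->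
  dot v a = dot v b -> dot (perp v) a < dot (perp v) b -> dot w a < dot w b ->
  0 < dot w (perp v).
Proof.
move=> /dotuu_gt0 v0 vab pab wab.
have := dot_decomp v w (b - a); rewrite !(dotDr, dotNr) vab subrr mulr0 add0r => e.
have : 0 < dot v v * (dot w b - dot w a) by rewrite mulr_gt0// subr_gt0.
by rewrite e pmulr_lgt0// subr_gt0.
Qed.

(* [perp v1] and [perp v2] run counterclockwise along the two supporting lines.
   Two bodies met in the same order on both would have crossing chords [a1 a2]
   and [b1 b2]; [w] is a functional separating them strictly. *)
Lemma order_reversal (R : realType) (v1 v2 w a1 a2 b1 b2 : 'rV[R]_2) :
  v1 != 0 -> v2 != 0 -> (det v1 v2 = 0 -> dot v1 v2 <= 0) ->
  dot v1 a1 = dot v1 b1 -> dot v2 a2 = dot v2 b2 ->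
  dot v1 a2 <= dot v1 b1 -> dot v1 b2 <= dot v1 b1 ->
  dot v2 a1 <= dot v2 b2 -> dot v2 b1 <= dot v2 b2 ->
  dot w a1 < dot w b1 -> dot w a1 < dot w b2 ->
  dot w a2 < dot w b1 -> dot w a2 < dot w b2 ->
  dot (perp v1) a1 < dot (perp v1) b1 -> dot (perp v2) b2 < dot (perp v2) a2.
Proof.
move=> v10 v20 npp e1 e2 v1a2 v1b2 v2a1 v2b1 w11 w12 w21 w22 s1.
rewrite ltNge; apply/negP => s2.
have {}s2 : dot (perp v2) a2 < dot (perp v2) b2.
  rewrite lt_neqAle s2 andbT; apply: contraTneq w22 => s2'.
  by rewrite (dot_inj v20 e2 s2') ltxx.
have y1 := slope_gt0 v10 e1 s1 w11.
have y2 := slope_gt0 v20 e2 s2 w22.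
have c1 := dot_cramer v1 v2 w (b2 - a1).
have c2 := dot_cramer v1 v2 w (b1 - a2).
rewrite !(dotDr, dotNr) in c1 c2.
(* By Cramer's rule, [b1 - a2] excludes a positive determinant and [b2 - a1] a negative one. *)
have d0 : det v1 v2 = 0.
  apply/eqP; rewrite eq_le; apply/andP; split; rewrite leNgt; apply/negP => d.
    have : 0 < det v1 v2 * (dot w b1 - dot w a2) by rewrite mulr_gt0// subr_gt0.
    by rewrite c2; nra.
  have : det v1 v2 * (dot w b2 - dot w a1) < 0 by rewrite nmulr_rlt0// subr_gt0.
  by rewrite c1; nra.
(* The directions are now opposite, so [w] cannot increase along both [perp v1] and [perp v2]. The
   products are expanded in the basis [w], [perp w]. *)
have := npp d0.
have w0 : w != 0 by apply: contraTneq w11 => ->; rewrite /dot !mxE !mul0r ltxx.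
have ww := dotuu_gt0 w0.
rewrite -(pmulr_rle0 _ ww).
have -> : dot w w * dot v1 v2 =
  dot w v1 * dot w v2 + dot w (perp v1) * dot w (perp v2).
  by rewrite /dot !perp0 !perp1; ring.
have : dot w v1 * dot w (perp v2) - dot w (perp v1) * dot w v2 = 0.
  transitivity (- dot w w * det v1 v2); last by rewrite d0 mulr0.
  by rewrite /dot /det !perp0 !perp1; ring.
move: y1 y2; move: (dot w v1) (dot w v2) (dot w (perp v1)) (dot w (perp v2)).
move=> x1 x2 z1 z2 z10 z20 h.
have x12 : 0 <= x1 * x2.
  rewrite -(pmulr_rge0 _ z10).
  have -> : z1 * (x1 * x2) = x1 * x1 * z2 - x1 * (x1 * z2 - z1 * x2) by ring.
  by rewrite h mulr0 subr0 mulr_ge0 ?(ltW z20)// -expr2 sqr_ge0.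
have := mulr_gt0 z10 z20; lra.
Qed.

(* A point [z] of the third body beyond the separating line [w] would be cut off
   from its contact points by the chord [b1 b2] of the middle body; [y] strictly
   separates the middle body from the third. *)
Lemma middle_shields (R : realType) (v1 v2 w y b1 b2 z : 'rV[R]_2) (c : R) :
  dot v1 z <= dot v1 b1 -> dot v2 z <= dot v2 b2 ->
  dot y b1 < dot y z -> dot y b2 < dot y z ->
  0 < dot y (perp v1) -> dot y (perp v2) < 0 ->
  0 < dot w (perp v1) -> dot w (perp v2) < 0 ->
  c <= dot w b1 -> c <= dot w b2 -> c < dot w z.
Proof.
move=> v1z v2z yb1 yb2 y1 y2 w1 w2 cb1 cb2; rewrite ltNge; apply/negP => wz.
have c1 := dot_cramer v1 w y (z - b1).
have c2 := dot_cramer v2 w y (z - b2).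
have d1 : det v1 w = dot w (perp v1) by rewrite /det /dot perp0 perp1; ring.
have d2 : det v2 w = dot w (perp v2) by rewrite /det /dot perp0 perp1; ring.
rewrite !(dotDr, dotNr) in c1 c2; rewrite d1 in c1; rewrite d2 in c2.
have k1 : 0 < dot w (perp v1) * (dot y z - dot y b1) by rewrite mulr_gt0// subr_gt0.
have k2 : dot w (perp v2) * (dot y z - dot y b2) < 0 by rewrite nmulr_rlt0// subr_gt0.
(* The sign of [dot y (perp w)] decides which contact point, [b1] or [b2], yields the
   contradiction. *)
have [h|h] := leP (dot y (perp w)) 0.
  by move: k1; rewrite c1; nra.
by move: k2; rewrite c2; nra.
Qed.

(** If [w] took equal values at [a] and [b], it would be parallel to [v]. But both bodies lie on one
    side of their tangent for [v], with points strictly off it, whereas [w] puts them on opposite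
    sides. *)
Lemma tangent_slope (R : realType) (A B : set 'rV[R]_2) (v w a b : 'rV[R]_2) (c : R) :
  body A -> body B -> v != 0 -> w != 0 -> A a -> B b ->
  dot v a = supp A v -> dot v b = supp B v -> supp A v = supp B v ->
  (forall x, A x -> dot w x <= c) -> (forall x, B x -> c <= dot w x) ->
  dot (perp v) a < dot (perp v) b -> 0 < dot w (perp v).
Proof.
move=> bA bB v0 w0 Aa Bb va vb vAB wA wB s.
have e : dot v a = dot v b by rewrite va vb.
have vv := dotuu_gt0 v0; have ww := dotuu_gt0 w0.
have [ab|ab] := ltP (dot w a) (dot w b); first exact: (slope_gt0 v0 e s ab).
have wac : dot w a = c.
  by apply/eqP; rewrite eq_le wA//= (le_trans (wB _ Bb)).
have wbc : dot w b = c.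
  by apply/eqP; rewrite eq_le wB// andbT -wac.
have p0 : dot w (perp v) = 0.
  have := dot_decomp v w (b - a).
  rewrite !(dotDr, dotNr) e wac wbc !subrr !mulr0 add0r => /esym/eqP.
  by rewrite mulf_eq0 subr_eq0 (gt_eqF s) orbF => /eqP.
have dec x y : dot v v * (dot w x - dot w y) = dot w v * (dot v x - dot v y).
  by have := dot_decomp v w (x - y); rewrite p0 mul0r addr0 !(dotDr, dotNr).
have [a' Aa' a'lt] := body_below bA v0.
have [b' Bb' b'lt] := body_below bB v0.
have := dec a' a; have := dec b' b; rewrite va vb wac wbc.
have := wA _ Aa'; have := wB _ Bb' => h1 h2 h3 h4.
have wv : dot w v = 0 by nra.
have : dot v v * dot w w = 0 by rewrite (dot_decomp v w w) p0 wv !mul0r addr0.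
by move/eqP; rewrite mulf_eq0 !gt_eqF.
Qed.

(** * Ordinary lines as common tangents *)

(** Depends on the union alone, so the bodies can be permuted by rewriting unions. *)
Definition has_ordinary (R : realType) (U : set 'rV[R]_2) : Prop :=
  exists L : set 'rV[R]_2, is_line L /\
    exists p q : 'rV[R]_2, p != q /\ L `&` U = [set p; q].

Lemma ordinary_of_touch (R : realType) (U A B : set 'rV[R]_2) (w p q : 'rV[R]_2) (c : R) :
  w != 0 -> A `&` B = set0 ->
  [set x | dot w x = c] `&` A = [set p] -> [set x | dot w x = c] `&` B = [set q] ->
  A `<=` U -> B `<=` U -> (forall x, U x -> dot w x = c -> A x \/ B x) ->
  has_ordinary U.
Proof.
move=> w0 AB Ap Bq AU BU UAB; exists [set x | dot w x = c]; split.
  exact: level_set_is_line.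
have [wp Ap'] : ([set x | dot w x = c] `&` A) p by rewrite Ap.
have [wq Bq'] : ([set x | dot w x = c] `&` B) q by rewrite Bq.
exists p, q; split.
  apply: contra_eq_neq AB => pq; apply/set0P; exists p; split => //.
  by rewrite pq.
apply/seteqP; split => [x [/= wx Ux]|x /= [->|->]]; last 2 first.
- by split => //; exact: AU.
- by split => //; exact: BU.
case: (UAB _ Ux wx) => [Ax|Bx]; [left|right].
  by have : ([set x | dot w x = c] `&` A) x by []; rewrite Ap.
by have : ([set x | dot w x = c] `&` B) x by []; rewrite Bq.
Qed.

Lemma body_touch (R : realType) (A : set 'rV[R]_2) (w : 'rV[R]_2) :
  body A -> w != 0 -> exists p, [set x | dot w x = supp A w] `&` A = [set p].
Proof.
move=> bA w0; have [cA sA _] := bA.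
have [p Ap wp] := supp_attained w cA (body_nonempty bA).
exists p; apply/seteqP; split => [x [/= wx Ax]|x /= ->//].
exact: (strictly_convex_max_uniq cA sA w0).
Qed.

(** The outer tangent, with both bodies on the same side. *)
Lemma ordinary_outer (R : realType) (U A B : set 'rV[R]_2) (w : 'rV[R]_2) :
  body A -> body B -> A `&` B = set0 -> w != 0 -> supp A w = supp B w ->
  A `<=` U -> B `<=` U -> (forall x, U x -> dot w x = supp A w -> A x \/ B x) ->
  has_ordinary U.
Proof.
move=> bA bB AB w0 sAB AU BU UAB.
have [p Ap] := body_touch bA w0; have [q Bq] := body_touch bB w0.
by rewrite -sAB in Bq; exact: (ordinary_of_touch w0 AB Ap Bq).
Qed.

(** The inner tangent: the maximum of [dot w] on [A] is its minimum on [B]. *)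
Lemma ordinary_inner (R : realType) (U A B : set 'rV[R]_2) (w : 'rV[R]_2) :
  body A -> body B -> A `&` B = set0 -> w != 0 -> supp A w = - supp B (- w) ->
  A `<=` U -> B `<=` U -> (forall x, U x -> dot w x = supp A w -> A x \/ B x) ->
  has_ordinary U.
Proof.
move=> bA bB AB w0 sAB AU BU UAB.
have Nw0 : - w != 0 by rewrite oppr_eq0.
have [p Ap] := body_touch bA w0; have [q Bq] := body_touch bB Nw0.
apply: (ordinary_of_touch w0 AB Ap _ AU BU UAB (q := q)).
rewrite -Bq; congr (_ `&` _); apply/seteqP; split => x /=; rewrite dotNl sAB.
  by move=> ->; rewrite opprK.
by move=> <-; rewrite opprK.
Qed.

Lemma supp_diff_continuous (R : realType) (A B : set 'rV[R]_2) :
  compact A -> A !=set0 -> compact B -> B !=set0 ->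
  continuous (fun u => supp A u - supp B u).
Proof.
move=> cA A0 cB B0 u.
exact: (continuousB (@supp_continuous _ _ cA A0 u) (@supp_continuous _ _ cB B0 u)).
Qed.

Lemma ordinary_two (R : realType) (A B : set 'rV[R]_2) :
  body A -> body B -> A `&` B = set0 -> has_ordinary (A `|` B).
Proof.
move=> bA bB AB; have [u u0 uAB] := body_separation bA bB AB.
have [cA _ _] := bA; have [cB _ _] := bB.
have A0 := body_nonempty bA; have B0 := body_nonempty bB.
have cf := supp_diff_continuous cA A0 cB B0.
have fZ k v : 0 <= k -> supp A (k *: v) - supp B (k *: v) = k * (supp A v - supp B v).
  by move=> k0; rewrite !suppZ// mulrBr.
have [a Aa] := A0; have [b Bb] := B0.
have := supp_ub u cA Aa; have := supp_ub (- u) cA Aa.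
have := supp_ub u cB Bb; have := supp_ub (- u) cB Bb; rewrite !dotNl => h1 h2 h3 h4.
(* As [u] separates [A] from [B], the difference of support functions is negative at [u] and
   positive at [- u]. *)
have [||v [_ [v0 _ /eqP + _ _]]] := two_zeros (u := - u) (u' := u) cf fZ; [lra|lra|].
rewrite subr_eq0 => /eqP sAB.
exact: (ordinary_outer bA bB AB v0 sAB).
Qed.

(** [B] is the middle body on the first line and, by [order_reversal], on the second. An inner
    tangent of [A] and [B] then has slopes of opposite signs along the two lines, so
    [middle_shields] keeps [C] off it. *)
Lemma ordinary_middle (R : realType) (A B C : set 'rV[R]_2)
    (v1 v2 a1 a2 b1 b2 c1 c2 : 'rV[R]_2) :
  body A -> body B -> body C ->
  A `&` B = set0 -> B `&` C = set0 ->
  v1 != 0 -> v2 != 0 -> (det v1 v2 = 0 -> dot v1 v2 <= 0) ->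
  supp A v1 = supp B v1 -> supp B v1 = supp C v1 ->
  supp A v2 = supp B v2 -> supp B v2 = supp C v2 ->
  A a1 -> A a2 -> B b1 -> B b2 -> C c1 -> C c2 ->
  dot v1 a1 = supp A v1 -> dot v2 a2 = supp A v2 ->
  dot v1 b1 = supp B v1 -> dot v2 b2 = supp B v2 ->
  dot v1 c1 = supp C v1 -> dot v2 c2 = supp C v2 ->
  dot (perp v1) a1 < dot (perp v1) b1 -> dot (perp v1) b1 < dot (perp v1) c1 ->
  has_ordinary (A `|` B `|` C).
Proof.
move=> bA bB bC AB BC v10 v20 npp AB1 BC1 AB2 BC2 Aa1 Aa2 Bb1 Bb2 Cc1 Cc2.
move=> ea1 ea2 eb1 eb2 ec1 ec2 sab sbc.
have [cA _ _] := bA; have [cB _ _] := bB; have [cC _ _] := bC.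
have A0 := body_nonempty bA; have B0 := body_nonempty bB.
have [x x0 xAB] := body_separation bA bB AB.
have [y y0 yBC] := body_separation bB bC BC.
have xs a b : A a -> B b -> dot x a < dot x b.
  move=> Aa Bb; have := supp_ub x cA Aa; have := supp_ub (- x) cB Bb.
  rewrite dotNl; lra.
have ys b c : B b -> C c -> dot y b < dot y c.
  move=> Bb Cc; have := supp_ub y cB Bb; have := supp_ub (- y) cC Cc.
  rewrite dotNl; lra.
have B1 z : B z -> dot v1 z <= supp B v1 by move=> ?; exact: supp_ub.
have B2 z : B z -> dot v2 z <= supp B v2 by move=> ?; exact: supp_ub.
have A1 z : A z -> dot v1 z <= supp B v1 by move=> ?; rewrite -AB1; exact: supp_ub.
have A2 z : A z -> dot v2 z <= supp B v2 by move=> ?; rewrite -AB2; exact: supp_ub.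
have C1 z : C z -> dot v1 z <= supp B v1 by move=> ?; rewrite BC1; exact: supp_ub.
have C2 z : C z -> dot v2 z <= supp B v2 by move=> ?; rewrite BC2; exact: supp_ub.
have e1 : dot v1 a1 = dot v1 b1 by rewrite ea1 eb1.
have e2 : dot v2 a2 = dot v2 b2 by rewrite ea2 eb2.
have f1 : dot v1 b1 = dot v1 c1 by rewrite ec1 eb1.
have f2 : dot v2 b2 = dot v2 c2 by rewrite ec2 eb2.
have tab : dot (perp v2) b2 < dot (perp v2) a2.
  by apply: (order_reversal (w := x) v10 v20 npp e1 e2 _ _ _ _ _ _ _ _ sab);
    rewrite ?eb1 ?eb2; auto.
have tbc : dot (perp v2) c2 < dot (perp v2) b2.
  by apply: (order_reversal (w := y) v10 v20 npp f1 f2 _ _ _ _ _ _ _ _ sbc);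
    rewrite -?f1 -?f2 ?eb1 ?eb2; auto.
have y1 : 0 < dot y (perp v1) by apply: (slope_gt0 v10 f1 sbc); auto.
have y2 : dot y (perp v2) < 0.
  rewrite -oppr_gt0 -dotNl.
  by apply: (slope_gt0 v20 (esym f2) tbc); rewrite !dotNl ltrN2; auto.
(* The nonzero zeros of this function are the normals of the inner tangents of [A] and [B]. *)
have cf : continuous (fun w : 'rV[R]_2 => supp A w + supp B (- w)).
  have cN : continuous (fun w : 'rV[R]_2 => supp B (- w)).
    move=> w; apply: (@continuous_comp _ _ _ (fun w : 'rV[R]_2 => - w) (supp B)).
      exact: opp_continuous.
    exact: (supp_continuous cB B0).
  by move=> w; exact: (continuousD (@supp_continuous _ _ cA A0 w) (cN w)).
have fZ k w : 0 <= k ->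
    supp A (k *: w) + supp B (- (k *: w)) = k * (supp A w + supp B (- w)).
  by move=> k0; rewrite -scalerN !suppZ// mulrDr.
have [||w [_ [w0 _ /eqP + _ _]]] := two_zeros (u := - x) (u' := x) cf fZ => //.
  have := supp_ub (- x) cA Aa1; have := supp_ub x cB Bb1; have := xs _ _ Aa1 Bb1.
  rewrite !opprK !dotNl; lra.
rewrite addr_eq0 => /eqP wAB.
have wA z : A z -> dot w z <= supp A w by exact: supp_ub.
have wB z : B z -> supp A w <= dot w z.
  by move=> Bz; rewrite wAB lerNl -dotNl supp_ub.
have w1 : 0 < dot w (perp v1).
  exact: (tangent_slope bA bB v10 w0 Aa1 Bb1 ea1 eb1 AB1 wA wB sab).
have w2 : dot w (perp v2) < 0.
  rewrite -oppr_gt0 -dotNl.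
  apply: (@tangent_slope _ B A v2 (- w) b2 a2 (- supp A w)) => //.
  - by rewrite oppr_eq0.
  - by move=> z Bz; rewrite dotNl lerN2 wB.
  - by move=> z Az; rewrite dotNl lerN2 wA.
apply: (ordinary_inner bA bB AB w0 wAB).
- by move=> z Az; left; left.
- by move=> z Bz; left; right.
move=> z [//|Cz] wz.
have : supp A w < dot w z.
  by apply: (middle_shields (y := y) (b1 := b1) (b2 := b2) _ _ _ _ y1 y2 w1 w2);
    rewrite ?eb1 ?eb2; auto.
by rewrite wz ltxx.
Qed.

Lemma ordinary_triple (R : realType) (A B C : set 'rV[R]_2) (v1 v2 : 'rV[R]_2) :
  body A -> body B -> body C ->
  A `&` B = set0 -> B `&` C = set0 -> A `&` C = set0 ->
  v1 != 0 -> v2 != 0 -> (det v1 v2 = 0 -> dot v1 v2 <= 0) ->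
  supp A v1 = supp B v1 -> supp B v1 = supp C v1 ->
  supp A v2 = supp B v2 -> supp B v2 = supp C v2 ->
  has_ordinary (A `|` B `|` C).
Proof.
move=> bA bB bC AB BC AC v10 v20 npp AB1 BC1 AB2 BC2.
have [cA _ _] := bA; have [cB _ _] := bB; have [cC _ _] := bC.
have BA : B `&` A = set0 by rewrite setIC.
have CB : C `&` B = set0 by rewrite setIC.
have CA : C `&` A = set0 by rewrite setIC.
have [a1 Aa1 ea1] := supp_attained v1 cA (body_nonempty bA).
have [a2 Aa2 ea2] := supp_attained v2 cA (body_nonempty bA).
have [b1 Bb1 eb1] := supp_attained v1 cB (body_nonempty bB).
have [b2 Bb2 eb2] := supp_attained v2 cB (body_nonempty bB).
have [c1 Cc1 ec1] := supp_attained v1 cC (body_nonempty bC).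
have [c2 Cc2 ec2] := supp_attained v2 cC (body_nonempty bC).
have ne (X Y : set 'rV[R]_2) x y : X `&` Y = set0 -> X x -> Y y -> dot v1 x = dot v1 y ->
    dot (perp v1) x != dot (perp v1) y.
  move=> XY Xx Yy e; apply/negP => /eqP /(dot_inj v10 e) xy.
  have : (X `&` Y) x by split => //; rewrite xy.
  by rewrite XY.
have AC1 : supp A v1 = supp C v1 by rewrite AB1.
have AC2 : supp A v2 = supp C v2 by rewrite AB2.
have : dot (perp v1) a1 != dot (perp v1) b1 by apply: ne AB _ _ _ => //; rewrite ea1 eb1.
have : dot (perp v1) b1 != dot (perp v1) c1 by apply: ne BC _ _ _ => //; rewrite ec1 eb1.
have : dot (perp v1) a1 != dot (perp v1) c1 by apply: ne AC _ _ _ => //; rewrite ec1 ea1.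
have EACB : A `|` B `|` C = A `|` C `|` B by rewrite -setUA (setUC B) setUA.
have EBAC : A `|` B `|` C = B `|` A `|` C by rewrite (setUC A).
have EBCA : A `|` B `|` C = B `|` C `|` A by rewrite setUC setUA setUAC (setUC C) setUAC.
have ECAB : A `|` B `|` C = C `|` A `|` B by rewrite setUC setUA.
have ECBA : A `|` B `|` C = C `|` B `|` A by rewrite setUC (setUC A) setUA.
(* Six of the eight sign patterns are the orders of the contact points; the other two are cyclic,
   hence absurd. *)
rewrite !neq_lt => /orP[ac|ca] /orP[bc|cb] /orP[ab|ba].
- exact: (ordinary_middle bA bB bC AB BC v10 v20 npp AB1 BC1 AB2 BC2
    Aa1 Aa2 Bb1 Bb2 Cc1 Cc2).
- rewrite EBAC; exact: (ordinary_middle bB bA bC BA AC v10 v20 npp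
    (esym AB1) AC1 (esym AB2) AC2 Bb1 Bb2 Aa1 Aa2 Cc1 Cc2).
- rewrite EACB; exact: (ordinary_middle bA bC bB AC CB v10 v20 npp
    AC1 (esym BC1) AC2 (esym BC2) Aa1 Aa2 Cc1 Cc2 Bb1 Bb2).
- by have := lt_trans (lt_trans cb ba) ac; rewrite ltxx.
- by have := lt_trans (lt_trans ab bc) ca; rewrite ltxx.
- rewrite EBCA; exact: (ordinary_middle bB bC bA BC CA v10 v20 npp
    BC1 (esym AC1) BC2 (esym AC2) Bb1 Bb2 Cc1 Cc2 Aa1 Aa2).
- rewrite ECAB; exact: (ordinary_middle bC bA bB CA AB v10 v20 npp
    (esym AC1) AB1 (esym AC2) AB2 Cc1 Cc2 Aa1 Aa2 Bb1 Bb2).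
- rewrite ECBA; exact: (ordinary_middle bC bB bA CB BA v10 v20 npp
    (esym BC1) (esym AB1) (esym BC2) (esym AB2) Cc1 Cc2 Bb1 Bb2 Aa1 Aa2).
Qed.

(** * Ties for the extreme among three bodies *)

Lemma suppU (R : realType) (A B : set 'rV[R]_2) (u : 'rV[R]_2) :
  compact A -> A !=set0 -> compact B -> B !=set0 ->
  supp (A `|` B) u = Num.max (supp A u) (supp B u).
Proof.
move=> cA A0 cB B0; have cAB := compactU cA cB.
have [a Aa au] := supp_attained u cA A0.
have [b Bb bu] := supp_attained u cB B0.
have AB0 : (A `|` B) !=set0 by exists a; left.
apply/eqP; rewrite eq_le ge_max -{2}au -{2}bu !supp_ub//; [|by right|by left].
rewrite andbT; have [x ABx <-] := supp_attained u cAB AB0.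
by case: ABx => /(supp_ub u); [move/(_ cA)|move/(_ cB)] => h; rewrite le_max h ?orbT.
Qed.

(** Unless [B] and [C] tie as well, the lower one stays strictly below the common tangent of [A] and
    the other. *)
Lemma supp_tie (R : realType) (A B C : set 'rV[R]_2) (u : 'rV[R]_2) :
  body A -> body B -> body C ->
  A `&` B = set0 -> A `&` C = set0 -> u != 0 ->
  supp A u = Num.max (supp B u) (supp C u) ->
  has_ordinary (A `|` B `|` C) \/ (supp A u = supp B u /\ supp B u = supp C u).
Proof.
move=> bA bB bC AB AC u0 e.
have [cB _ _] := bB; have [cC _ _] := bC.
have [h|h|h] := ltgtP (supp B u) (supp C u); [left|left|right].
- rewrite (max_r (ltW h)) in e.
  apply: (ordinary_outer bA bC AC u0 e).
  + by move=> x Ax; left; left.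
  + by move=> x Cx; right.
  move=> x [[Ax|Bx]|Cx] ux; [by left| |by right].
  by have := supp_ub u cB Bx; rewrite ux e leNgt h.
- rewrite (max_l (ltW h)) in e.
  apply: (ordinary_outer bA bB AB u0 e).
  + by move=> x Ax; left; left.
  + by move=> x Bx; left; right.
  move=> x [[Ax|Bx]|Cx] ux; [by left|by right|].
  by have := supp_ub u cC Cx; rewrite ux e leNgt h.
- by rewrite e h maxxx.
Qed.

(* A direction in which only [A] is extreme and one in which [A] is not extreme
   are joined by two arcs of directions, and [A] ties for the extreme on both. *)
Lemma ordinary_of_extreme (R : realType) (A B C : set 'rV[R]_2) (u : 'rV[R]_2) :
  body A -> body B -> body C ->
  A `&` B = set0 -> B `&` C = set0 -> A `&` C = set0 ->
  Num.max (supp B u) (supp C u) < supp A u ->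
  has_ordinary (A `|` B `|` C).
Proof.
move=> bA bB bC AB BC AC uA.
have [cA _ _] := bA; have [cB _ _] := bB; have [cC _ _] := bC.
have A0 := body_nonempty bA; have B0 := body_nonempty bB; have C0 := body_nonempty bC.
have cBC := compactU cB cC.
have BC0 : (B `|` C) !=set0 by have [b Bb] := B0; exists b; left.
have [u' u'0 u'AB] := body_separation bA bB AB.
have u'A : supp A u' - supp (B `|` C) u' < 0.
  have [b Bb] := B0.
  have := supp_ub u' cBC (or_introl Bb : (B `|` C) b).
  by have := supp_ub (- u') cB Bb; rewrite dotNl; lra.
rewrite -(suppU u cB B0 cC C0) -subr_gt0 in uA.
have cf := supp_diff_continuous cA A0 cBC BC0.
have fZ k v : 0 <= k ->
    supp A (k *: v) - supp (B `|` C) (k *: v) = k * (supp A v - supp (B `|` C) v).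
  by move=> k0; rewrite !suppZ// mulrBr.
have [v1 [v2 [v10 v20 /eqP + /eqP + npp]]] := two_zeros cf fZ uA u'A.
rewrite !subr_eq0 !suppU// => /eqP e1 /eqP e2.
have [hU|[AB1 BC1]] := supp_tie bA bB bC AB AC v10 e1; first exact: hU.
have [hU|[AB2 BC2]] := supp_tie bA bB bC AB AC v20 e2; first exact: hU.
exact: (ordinary_triple bA bB bC AB BC AC v10 v20 npp).
Qed.

Lemma ordinary_three (R : realType) (A B C : set 'rV[R]_2) :
  body A -> body B -> body C ->
  A `&` B = set0 -> B `&` C = set0 -> A `&` C = set0 ->
  has_ordinary (A `|` B `|` C).
Proof.
move=> bA bB bC AB BC AC.
have BA : B `&` A = set0 by rewrite setIC.
have CB : C `&` B = set0 by rewrite setIC.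
have CA : C `&` A = set0 by rewrite setIC.
(* In each direction one body alone is extreme, exactly two are, or all three tie; only the last
   case gives no ordinary line at once. *)
have dir (u : 'rV[R]_2) : u != 0 -> has_ordinary (A `|` B `|` C) \/
    (supp A u = supp B u /\ supp B u = supp C u).
  move=> u0.
  have [hA|hA|hA] := ltgtP (Num.max (supp B u) (supp C u)) (supp A u).
  - by left; exact: (ordinary_of_extreme bA bB bC AB BC AC hA).
  - have [h|h|h] := ltgtP (supp B u) (supp C u).
    + left; rewrite setUC setUA.
      apply: (ordinary_of_extreme (u := u) bC bA bB CA AB CB).
      by rewrite gt_max h andbT; move: hA; rewrite (max_r (ltW h)).
    + left; rewrite (setUC A).
      apply: (ordinary_of_extreme (u := u) bB bA bC BA AC BC).
      by rewrite gt_max h andbT; move: hA; rewrite (max_l (ltW h)).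
    + rewrite h maxxx -h in hA.
      have e : supp B u = Num.max (supp A u) (supp C u).
        by rewrite -h (max_r (ltW hA)).
      have [hU|[e1 e2]] := supp_tie bB bA bC BA BC u0 e.
        by left; rewrite (setUC A).
      by right; split; [rewrite e1|rewrite e1].
  - exact: (supp_tie bA bB bC AB AC u0 (esym hA)).
have [u u0] : exists u : 'rV[R]_2, u != 0.
  by exists (const_mx 1); apply/eqP => /matrixP/(_ 0 0)/eqP; rewrite !mxE oner_eq0.
have Nu0 : - u != 0 by rewrite oppr_eq0.
have [hU|[AB1 BC1]] := dir u u0; first exact: hU.
have [hU|[AB2 BC2]] := dir (- u) Nu0; first exact: hU.
apply: (ordinary_triple bA bB bC AB BC AC u0 Nu0) => // _.
by rewrite dotNr oppr_le0 ltW// dotuu_gt0.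
Qed.

(** * Four or more bodies *)

Definition pt (R : realType) (a b : R) : 'rV[R]_2 := \row_i (if i == 0 then a else b).

Lemma dot_pt (R : realType) (w : 'rV[R]_2) (a b : R) :
  dot w (pt a b) = w 0 0 * a + w 0 1 * b.
Proof. by rewrite /dot !mxE. Qed.

Lemma pt_neq (R : realType) (a b c d : R) : a != c -> pt a b != pt c d.
Proof.
by move=> ac; apply: contra_neq ac => /matrixP/(_ 0 0); rewrite !mxE.
Qed.

Lemma set2_no_three (T : eqType) (p q x y z : T) :
  x != y -> y != z -> x != z ->
  [set p; q] x -> [set p; q] y -> [set p; q] z -> False.
Proof.
move=> /eqP xy /eqP yz /eqP xz.
by move=> /= [ex|ex] [ey|ey] [ez|ez]; subst; auto.
Qed.

Lemma two_points_one_side (R : realType) (U K : set 'rV[R]_2) (w p q : 'rV[R]_2) (c : R) :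
  strictly_convex K -> K `<=` U -> w != 0 ->
  [set x | dot w x = c] `&` U = [set p; q] ->
  (forall x, K x -> dot w x <= c) \/ (forall x, K x -> c <= dot w x).
Proof.
move=> sK KU w0 Lpq; apply: contrapT => /not_orP[].
move=> /existsNP[y /not_implyP[Ky /negP]]; rewrite -ltNge => cy.
move=> /existsNP[x /not_implyP[Kx /negP]]; rewrite -ltNge => xc.
have xy : x != y by apply: contraTneq xc => ->; rewrite -leNgt ltW.
have d0 : 0 < dot w y - dot w x by lra.
pose t := (c - dot w x) / (dot w y - dot w x).
have td : t * (dot w y - dot w x) = c - dot w x by rewrite divfK ?lt0r_neq0.
have t01 : 0 < t < 1.
  by rewrite divr_gt0 ?ltr_pdivrMr//=; lra.
(* The crossing point is interior to [K], so the line meets [K] in a segment. *)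
have [z zK wz] : exists2 z, interior K z & dot w z = c.
  exists ((1 - t) *: x + t *: y); first exact: sK.
  by rewrite dotDr !dotZr; lra.
have [s s0 Ks] := interior_shift (perp w) zK.
have [s' s'0 Ks'] := interior_shift (- perp w) zK.
have pw : 0 < dot (perp w) (perp w).
  have -> : dot (perp w) (perp w) = dot w w by rewrite /dot perp0 perp1; ring.
  exact: dotuu_gt0.
have n1 : dot (perp w) z < dot (perp w) (z + s *: perp w).
  by rewrite dotDr dotZr ltrDl mulr_gt0.
have n2 : dot (perp w) (z + s' *: - perp w) < dot (perp w) z.
  by rewrite dotDr dotZr dotNr gtrDl mulrN oppr_lt0 mulr_gt0.
apply: (@set2_no_three _ p q (z + s' *: - perp w) z (z + s *: perp w)).
- by apply: contraTneq n2 => ->; rewrite ltxx.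
- by apply: contraTneq n1 => <-; rewrite ltxx.
- by apply: contraTneq (lt_trans n2 n1) => ->; rewrite ltxx.
- rewrite -Lpq; split; last exact: KU.
  by rewrite /= dotDr dotZr dotNr dot_perp wz; ring.
- by rewrite -Lpq; split => //; apply: KU; exact: interior_subset.
- rewrite -Lpq; split; last exact: KU.
  by rewrite /= dotDr dotZr dot_perp wz; ring.
Qed.

(** The midpoint of [p] and [q] would be a third common point. *)
Lemma two_points_not_same (R : realType) (U K : set 'rV[R]_2) (w p q : 'rV[R]_2) (c : R) :
  strictly_convex K -> K `<=` U -> p != q ->
  [set x | dot w x = c] `&` U = [set p; q] -> K p -> K q -> False.
Proof.
move=> sK KU pq Lpq Kp Kq.
have [wp Up] : ([set x | dot w x = c] `&` U) p by rewrite Lpq; left.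
have [wq Uq] : ([set x | dot w x = c] `&` U) q by rewrite Lpq; right.
have h : 0 < (2^-1 : R) < 1 by apply/andP; split; lra.
have h2 : (2^-1 : R) != 0 by rewrite invr_eq0 pnatr_eq0.
have Kz := interior_subset (sK p q _ Kp Kq pq h).
apply: (@set2_no_three _ p q p ((1 - 2^-1) *: p + 2^-1 *: q) q) => //.
- rewrite -subr_eq0.
  have -> : p - ((1 - 2^-1) *: p + 2^-1 *: q) = 2^-1 *: (p - q).
    by apply/rowP => i; rewrite !mxE; ring.
  by rewrite scaler_eq0 (negbTE h2) subr_eq0 (negbTE pq).
- rewrite -subr_eq0.
  have -> : (1 - 2^-1) *: p + 2^-1 *: q - q = 2^-1 *: (p - q).
    by apply/rowP => i; rewrite !mxE; field.
  by rewrite scaler_eq0 (negbTE h2) subr_eq0 (negbTE pq).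
- by left.
- rewrite -Lpq; split; last exact: KU.
  by move: wp wq; rewrite /= dotDr !dotZr => -> ->; ring.
- by right.
Qed.

(** Supplies a point of [K] at the height of any given point of the strip, for horizontal
    comparison. *)
Lemma vertical_edge (R : realType) (K : set 'rV[R]_2) (e a : R) :
  strictly_convex K -> K (pt e 1) -> K (pt e (-1)) -> -1 <= a <= 1 -> K (pt e a).
Proof.
move=> sK K1 KN1 /andP[a0 a1].
have -> : pt e a = (1 - (1 + a) / 2) *: pt e (-1) + (1 + a) / 2 *: pt e 1.
  by apply: row2P; rewrite !mxE /=; field.
by apply: strictly_convex_conv => //; apply/andP; split; lra.
Qed.

(* Under these hypotheses no line can separate the four bodies into two
   nonempty groups, so a line with only two points in [U] supports all of them;
   but the supporting lines with a horizontal normal touch a single body and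
   those with a vertical normal touch three. *)
Lemma no_ordinary_of_frame (R : realType) (U A B C D : set 'rV[R]_2) :
  strictly_convex A -> strictly_convex B -> strictly_convex C -> strictly_convex D ->
  A `<=` U -> B `<=` U -> C `<=` U -> D `<=` U ->
  A (pt (-1) 1) -> A (pt (-1) (-1)) -> A (pt (- (3 / 5)) 0) ->
  C (pt 1 1) -> C (pt 1 (-1)) -> C (pt (3 / 5) 0) ->
  B (pt 0 1) -> B (pt (- (5 / 8)) (3 / 5)) -> B (pt (5 / 8) (3 / 5)) ->
  D (pt 0 (-1)) -> D (pt (- (5 / 8)) (- (3 / 5))) -> D (pt (5 / 8) (- (3 / 5))) ->
  (forall x, U x -> -1 <= x 0 1 <= 1) ->
  (forall x, U x -> ~ A x -> -1 < x 0 0) -> (forall x, U x -> ~ C x -> x 0 0 < 1) ->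
  ~ has_ordinary U.
Proof.
move=> sA sB sC sD AU BU CU DU A1 A2 A3 C1 C2 C3 B1 B2 B3 D1 D2 D3 U1 UA UC.
move=> [L [/is_line_level_set[w0 [c0 [w00 ->]]] [p [q [pq Lpq0]]]]].
suff main w c : w != 0 -> [set x | dot w x = c] `&` U = [set p; q] ->
    (forall x, A x -> dot w x <= c) -> False.
  have [h|h] := two_points_one_side sA AU w00 Lpq0; first exact: (main w0 c0).
  apply: (main (- w0) (- c0)); first by rewrite oppr_eq0.
  - rewrite -Lpq0; congr (_ `&` _); apply/seteqP.
    by split => x /=; rewrite dotNl; [apply: oppr_inj|move=> ->].
  - by move=> x Ax; rewrite dotNl lerN2 h.
move=> {w0 c0 w00 Lpq0} w0 Lpq hA.
have wn0 : w 0 0 = 0 -> w 0 1 = 0 -> False.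
  by move=> e0 e1; move/eqP: w0; apply; apply: row2P; rewrite mxE.
have := hA _ A1; have := hA _ A2; have := hA _ A3; rewrite !dot_pt => a3 a2 a1.
have oneK K x y z : strictly_convex K -> K `<=` U -> K x -> K y -> K z ->
    [/\ dot w x <= c, dot w y <= c & dot w z <= c] /\ (forall x, K x -> dot w x <= c) \/
    [/\ c <= dot w x, c <= dot w y & c <= dot w z].
  move=> sK KU Kx Ky Kz; have [h|h] := two_points_one_side sK KU w0 Lpq.
    by left; split => //; split; exact: h.
  by right; split; exact: h.
have := oneK C _ _ _ sC CU C1 C2 C3; have := oneK B _ _ _ sB BU B1 B2 B3.
have := oneK D _ _ _ sD DU D1 D2 D3; rewrite !dot_pt => {oneK}.
(* If any of [B], [C], [D] lies opposite to [A], the inequalities at the frame points force [w = 0].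
   Only the case of all four on one side survives. *)
case=> [[[d1 d2 d3] hD]|[d1 d2 d3]]; case=> [[[b1 b2 b3] hB]|[b1 b2 b3]];
  case=> [[[c1 c2 c3] hC]|[c1 c2 c3]]; try by apply: wn0; lra.
have [wp Up] : ([set x | dot w x = c] `&` U) p by rewrite Lpq; left.
have [wq Uq] : ([set x | dot w x = c] `&` U) q by rewrite Lpq; right.
have [w00|w00|w00] := ltgtP (w 0 0) 0.
(* A point outside [A] is strictly to the right of the point of [A] at its height on the vertical
   edge, hence strictly below the maximum of [dot w]. *)
- have inA x : U x -> dot w x = c -> A x.
    move=> Ux wx; apply: contrapT => nAx; have x0 := UA _ Ux nAx.
    have := hA _ (vertical_edge sA A1 A2 (U1 _ Ux)).
    by rewrite dot_pt -wx /dot; nra.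
  exact: (two_points_not_same sA AU pq Lpq (inA _ Up wp) (inA _ Uq wq)).
- have inC x : U x -> dot w x = c -> C x.
    move=> Ux wx; apply: contrapT => nCx; have x0 := UC _ Ux nCx.
    have := hC _ (vertical_edge sC C1 C2 (U1 _ Ux)).
    by rewrite dot_pt -wx /dot; nra.
  exact: (two_points_not_same sC CU pq Lpq (inC _ Up wp) (inC _ Uq wq)).
have /andP[p1 p2] := U1 _ Up.
rewrite /= /dot w00 mul0r add0r in wp.
have three y : w 0 1 * y = c -> U (pt (-1) y) -> U (pt 0 y) -> U (pt 1 y) -> False.
  move=> wy Ux Uy Uz;
  apply: (@set2_no_three _ p q (pt (-1) y) (pt 0 y) (pt 1 y)).
  - by apply: pt_neq; rewrite oppr_eq0.
  - by apply: pt_neq; rewrite eq_sym.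
  - by apply: pt_neq; apply/eqP; lra.
  - by rewrite -Lpq; split => //=; rewrite dot_pt w00 wy mul0r add0r.
  - by rewrite -Lpq; split => //=; rewrite dot_pt w00 wy mul0r add0r.
  - by rewrite -Lpq; split => //=; rewrite dot_pt w00 wy mul0r add0r.
(* The points of [A] give [c >= |w 0 1|] and the height of [p] gives the converse, so the line has
   height 1 or -1. *)
have [w01|w01|w01] := ltgtP (w 0 1) 0; last exact: wn0.
- by apply: (three (-1)); [nra|exact: AU|exact: DU|exact: CU].
- by apply: (three 1); [nra|exact: AU|exact: BU|exact: CU].
Qed.

(** * Ellipses *)

Definition ellipse (R : realType) (a b r s : R) : set 'rV[R]_2 :=
  [set x | ((x 0 0 - a) / r) ^+ 2 + ((x 0 1 - b) / s) ^+ 2 <= 1].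

(** Cauchy-Schwarz. The parameter [g] bounds the square root in the support function of the ellipse,
    so rational bounds suffice. *)
Lemma ellipse_le (R : realType) (a b r s p q g : R) (x : 'rV[R]_2) :
  0 < r -> 0 < s -> 0 <= g -> (p * r) ^+ 2 + (q * s) ^+ 2 <= g ^+ 2 ->
  ellipse a b r s x -> p * x 0 0 + q * x 0 1 <= p * a + q * b + g.
Proof.
move=> r0 s0 g0 pqg; rewrite /ellipse /=.
set X := (x 0 0 - a) / r; set Y := (x 0 1 - b) / s => XY.
have -> : x 0 0 = r * X + a by rewrite mulrC divfK ?lt0r_neq0// subrK.
have -> : x 0 1 = s * Y + b by rewrite mulrC divfK ?lt0r_neq0// subrK.
suff : (p * r) * X + (q * s) * Y <= g by lra.
apply: le_trans (ler_norm _) _.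
rewrite -(@ler_pXn2r _ 2)// ?nnegrE// -normrX ger0_norm ?sqr_ge0//.
apply: le_trans pqg; set P := p * r; set Q := q * s.
apply: (@le_trans _ _ ((P ^+ 2 + Q ^+ 2) * (X ^+ 2 + Y ^+ 2))).
  rewrite -subr_ge0.
  have -> : (P ^+ 2 + Q ^+ 2) * (X ^+ 2 + Y ^+ 2) - (P * X + Q * Y) ^+ 2 =
    (P * Y - Q * X) ^+ 2 by ring.
  exact: sqr_ge0.
by rewrite ler_piMr// addr_ge0// sqr_ge0.
Qed.

Lemma ellipse_continuous (R : realType) (a b r s : R) : continuous
  (fun x : 'rV[R]_2 => ((x 0 0 - a) / r) ^+ 2 + ((x 0 1 - b) / s) ^+ 2 : R).
Proof.
have cf (c t : R) (i : 'I_2) :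
    continuous (fun x : 'rV[R]_2 => ((x 0 i - c) / t) ^+ 2 : R).
  move=> x.
  apply: (@continuous_comp _ _ _ (fun x : 'rV[R]_2 => x 0 i)
    (fun z : R => ((z - c) / t) ^+ 2)).
    exact: coord_continuous.
  apply: (@continuous_comp _ _ _ (fun z : R => (z - c) / t) (fun z : R => z ^+ 2)).
    apply: (@continuous_comp _ _ _ (fun z : R => z - c) ( *%R^~ t^-1)).
      by apply: cvgB; [exact: cvg_id|exact: cvg_cst].
    exact: mulrr_continuous.
  exact: exprn_continuous.
by move=> x; exact: (continuousD (@cf a r 0 x) (@cf b s 1 x)).
Qed.

Lemma ellipse_interior (R : realType) (a b r s : R) (x : 'rV[R]_2) :
  ((x 0 0 - a) / r) ^+ 2 + ((x 0 1 - b) / s) ^+ 2 < 1 -> interior (ellipse a b r s) x.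
Proof.
move=> x1.
have o : open [set x : 'rV[R]_2 |
    ((x 0 0 - a) / r) ^+ 2 + ((x 0 1 - b) / s) ^+ 2 < 1].
  apply: (@open_comp _ _ _ [set y : R | y < 1]); last exact: open_lt.
  by move=> y _; exact: ellipse_continuous.
by apply: (filterS _ (open_nbhs_nbhs (conj o x1))) => y /ltW.
Qed.

Lemma ellipse_body (R : realType) (a b r s : R) : 0 < r -> 0 < s ->
  body (ellipse a b r s).
Proof.
move=> r0 s0; split.
- have cl : closed (ellipse a b r s).
    apply: (@closed_comp _ _ _ [set y : R | y <= 1]); last exact: closed_le.
    by move=> y _; exact: ellipse_continuous.
  have cB : compact [set v : 'rV[R]_2 | forall i,
      [set` `[(if i == 0 then a - r else b - s), (if i == 0 then a + r else b + s)]] (v ord0 i)].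
    apply: (@rV_compact _ _ (fun i => [set` `[(if i == 0 then a - r else b - s),
      (if i == 0 then a + r else b + s)]])) => i; exact: segment_compact.
  apply: (subclosed_compact cl cB) => x Ex i.
  have x1 := ellipse_le (p := 1) (q := 0) (g := r) r0 s0 (ltW r0) _ Ex.
  have x2 := ellipse_le (p := -1) (q := 0) (g := r) r0 s0 (ltW r0) _ Ex.
  have y1 := ellipse_le (p := 0) (q := 1) (g := s) r0 s0 (ltW s0) _ Ex.
  have y2 := ellipse_le (p := 0) (q := -1) (g := s) r0 s0 (ltW s0) _ Ex.
  case: i => -[|[|//]] ik /=; rewrite in_itv /=.
    have -> : Ordinal ik = 0 by exact: val_inj.
    by apply/andP; split; [have := x2 ltac:(nra)|have := x1 ltac:(nra)]; lra.
  have -> : Ordinal ik = 1 by exact: val_inj.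
  by apply/andP; split; [have := y2 ltac:(nra)|have := y1 ltac:(nra)]; lra.
- move=> x y t Ex Ey xy /andP[t0 t1]; apply: ellipse_interior.
  move: Ex Ey; rewrite /ellipse /= !mxE => Ex Ey.
  have r0' := lt0r_neq0 r0; have s0' := lt0r_neq0 s0.
  have d0 : 0 < ((x 0 0 - y 0 0) / r) ^+ 2 + ((x 0 1 - y 0 1) / s) ^+ 2.
    rewrite lt_neqAle addr_ge0 ?sqr_ge0// andbT eq_sym.
    apply: contra xy; rewrite paddr_eq0 ?sqr_ge0// !sqrf_eq0 !mulf_eq0 !invr_eq0.
    rewrite (negbTE r0') (negbTE s0') !orbF !subr_eq0 => /andP[/eqP e0 /eqP e1].
    by apply/eqP/row2P.
  (* The exact convexity defect of the quadratic form, which makes the inequality strict. *)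
  set f := _ + _; have -> : f =
    (1 - t) * (((x 0 0 - a) / r) ^+ 2 + ((x 0 1 - b) / s) ^+ 2) +
    t * (((y 0 0 - a) / r) ^+ 2 + ((y 0 1 - b) / s) ^+ 2) -
    t * (1 - t) * (((x 0 0 - y 0 0) / r) ^+ 2 + ((x 0 1 - y 0 1) / s) ^+ 2).
    by rewrite /f; field; rewrite r0' s0'.
  have tt : 0 < t * (1 - t) by rewrite mulr_gt0// subr_gt0.
  have := mulr_gt0 tt d0.
  move: Ex Ey; set fx := _ + _ => fx1; set fy := _ + _ => fy1.
  have h1 : (1 - t) * fx <= 1 - t by rewrite ler_piMr// subr_ge0 ltW.
  have h2 : t * fy <= t by rewrite ler_piMr// ltW.
  lra.
- exists (pt a b); apply: ellipse_interior.
  by rewrite !mxE /= !subrr !mul0r expr0n addr0 ltr01.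
Qed.

(** * The witness family *)

(* Bodies 0-3 are the left, top, right and bottom ellipses; the others are discs
   of radius [e] whose centres are at least [3 e] apart and, as [k < n], lie left
   of [(3 / 10, 0)]. *)
Definition witness (R : realType) (n k : nat) : set 'rV[R]_2 :=
  let e := (10 * n%:R)^-1 in
  match k with
  | 0 => ellipse (-1) 0 (2 / 5) 1
  | 1 => ellipse 0 (3 / 5) (5 / 8) (2 / 5)
  | 2 => ellipse 1 0 (2 / 5) 1
  | 3 => ellipse 0 (- (3 / 5)) (5 / 8) (2 / 5)
  | _ => ellipse (3 * e * k%:R) 0 e e
  end.

(** The two slanted lines are tangent to the left ellipse: its half-axes turn the normal [(10, 3)]
    into [(4, 3)], of length 5. They separate it from the top and the bottom ellipse
    respectively. *)
Lemma witness0_bounds (R : realType) (n : nat) (x : 'rV[R]_2) : witness n 0 x ->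
  [/\ -1 <= x 0 1, x 0 1 <= 1, 10 * x 0 0 + 3 * x 0 1 <= -5 &
      10 * x 0 0 - 3 * x 0 1 <= -5].
Proof.
move=> Wx; have r0 : 0 < (2 / 5 : R) by lra. have s0 : 0 < (1 : R) by lra.
have h p q g h1 h2 := @ellipse_le _ _ _ _ _ p q g x r0 s0 h1 h2 Wx.
split.
- by have := h 0 (-1) 1 ltac:(lra) ltac:(nra); lra.
- by have := h 0 1 1 ltac:(lra) ltac:(nra); lra.
- by have := h 10 3 5 ltac:(lra) ltac:(nra); lra.
- by have := h 10 (-3) 5 ltac:(lra) ltac:(nra); lra.
Qed.

Lemma witness2_bounds (R : realType) (n : nat) (x : 'rV[R]_2) : witness n 2 x ->
  [/\ -1 <= x 0 1, x 0 1 <= 1, 5 <= 10 * x 0 0 + 3 * x 0 1 &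
      5 <= 10 * x 0 0 - 3 * x 0 1].
Proof.
move=> Wx; have r0 : 0 < (2 / 5 : R) by lra. have s0 : 0 < (1 : R) by lra.
have h p q g h1 h2 := @ellipse_le _ _ _ _ _ p q g x r0 s0 h1 h2 Wx.
split.
- by have := h 0 (-1) 1 ltac:(lra) ltac:(nra); lra.
- by have := h 0 1 1 ltac:(lra) ltac:(nra); lra.
- by have := h (-10) (-3) 5 ltac:(lra) ltac:(nra); lra.
- by have := h (-10) 3 5 ltac:(lra) ltac:(nra); lra.
Qed.

Lemma witness1_bounds (R : realType) (n : nat) (x : 'rV[R]_2) : witness n 1 x ->
  [/\ -1 < x 0 0, x 0 0 < 1, 1 / 5 <= x 0 1, x 0 1 <= 1 &
      -5 < 10 * x 0 0 + 3 * x 0 1 /\ 10 * x 0 0 - 3 * x 0 1 < 5].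
Proof.
move=> Wx; have r0 : 0 < (5 / 8 : R) by lra. have s0 : 0 < (2 / 5 : R) by lra.
have h p q g h1 h2 := @ellipse_le _ _ _ _ _ p q g x r0 s0 h1 h2 Wx.
split.
- by have := h (-1) 0 (5 / 8) ltac:(lra) ltac:(nra); lra.
- by have := h 1 0 (5 / 8) ltac:(lra) ltac:(nra); lra.
- by have := h 0 (-1) (2 / 5) ltac:(lra) ltac:(nra); lra.
- by have := h 0 1 (2 / 5) ltac:(lra) ltac:(nra); lra.
- split.
    (* [13 / 2] exceeds the square root of [(25 / 4) ^+ 2 + (6 / 5) ^+ 2], and [13 / 2 - 9 / 5 < 5]
       leaves a gap to the tangent of the left ellipse. *)
    by have := h (-10) (-3) (13 / 2) ltac:(lra) ltac:(nra); lra.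
  by have := h 10 (-3) (13 / 2) ltac:(lra) ltac:(nra); lra.
Qed.

Lemma witness3_bounds (R : realType) (n : nat) (x : 'rV[R]_2) : witness n 3 x ->
  [/\ -1 < x 0 0, x 0 0 < 1, -1 <= x 0 1, x 0 1 <= - (1 / 5) &
      -5 < 10 * x 0 0 - 3 * x 0 1 /\ 10 * x 0 0 + 3 * x 0 1 < 5].
Proof.
move=> Wx; have r0 : 0 < (5 / 8 : R) by lra. have s0 : 0 < (2 / 5 : R) by lra.
have h p q g h1 h2 := @ellipse_le _ _ _ _ _ p q g x r0 s0 h1 h2 Wx.
split.
- by have := h (-1) 0 (5 / 8) ltac:(lra) ltac:(nra); lra.
- by have := h 1 0 (5 / 8) ltac:(lra) ltac:(nra); lra.
- by have := h 0 (-1) (2 / 5) ltac:(lra) ltac:(nra); lra.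
- by have := h 0 1 (2 / 5) ltac:(lra) ltac:(nra); lra.
- split.
    by have := h (-10) 3 (13 / 2) ltac:(lra) ltac:(nra); lra.
  by have := h 10 3 (13 / 2) ltac:(lra) ltac:(nra); lra.
Qed.

(** With [e * n = 1 / 10], the centres have abscissa between 0 and [3 / 10], and the radius is at
    most [1 / 40]. *)
Lemma witness4_bounds (R : realType) (n k : nat) (x : 'rV[R]_2) :
  (3 < n)%N -> (k.+4 < n)%N -> witness n k.+4 x ->
  let e := (10 * n%:R)^-1 in
  [/\ 3 * e * k.+4%:R - e <= x 0 0, x 0 0 <= 3 * e * k.+4%:R + e,
      - (1 / 2) < x 0 0 < 2 / 5 & - (1 / 10) < x 0 1 < 1 / 10].
Proof.
move=> n3 kn Wx e.
have n4 : 4 <= n%:R :> R by rewrite ler_nat.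
have n10 : 0 < 10 * n%:R :> R by lra.
have e0 : 0 < e by rewrite invr_gt0.
have en : e * n%:R = 1 / 10.
  by rewrite /e; field; rewrite lt0r_neq0//; lra.
have e1 : e <= 1 / 40 by nra.
have kn' : k.+4%:R <= n%:R :> R by rewrite ler_nat ltnW.
have k0 : 0 <= k.+4%:R :> R by [].
have ek : e * k.+4%:R <= 1 / 10 by rewrite -en ler_wpM2l// ltW.
have ek0 : 0 <= e * k.+4%:R by rewrite mulr_ge0// ltW.
have h p q g h1 h2 := @ellipse_le _ _ _ _ _ p q g x e0 e0 h1 h2 Wx.
have x1 := h (-1) 0 e ltac:(lra) ltac:(nra).
have x2 := h 1 0 e ltac:(lra) ltac:(nra).
have y1 := h 0 (-1) e ltac:(lra) ltac:(nra).
have y2 := h 0 1 e ltac:(lra) ltac:(nra).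
rewrite -!(mulrA 3) in x1 x2 *.
rewrite !(mul0r, mulr0) !add0r in y1 y2.
move: ek ek0 x1 x2; move: (e * _) => m ek ek0 x1 x2.
by clear h; split; [lra|lra|apply/andP; split; lra|apply/andP; split; lra].
Qed.

Lemma witness_body (R : realType) (n k : nat) : (0 < n)%N -> body (@witness R n k).
Proof.
move=> n0; have e0 : 0 < (10 * n%:R)^-1 :> R by rewrite invr_gt0 mulr_gt0 ?ltr0n.
by case: k => [|[|[|[|k]]]]; apply: ellipse_body; rewrite // ?divr_gt0.
Qed.

Lemma witness_disjoint (R : realType) (n i j : nat) : (3 < n)%N -> (j < n)%N ->
  (i < j)%N -> @witness R n i `&` witness n j = set0.
Proof.
move=> n3 jn ij; apply/seteqP; split => // x [].
case: i ij => [|[|[|[|i]]]]; case: j jn => [|[|[|[|j]]]] // jn ij.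
- by move=> /witness0_bounds[_ _ a1 a2] /witness1_bounds[_ _ _ _ [b1 b2]]; lra.
- by move=> /witness0_bounds[_ _ a1 a2] /witness2_bounds[_ _ b1 b2]; lra.
- by move=> /witness0_bounds[_ _ a1 a2] /witness3_bounds[_ _ _ _ [b1 b2]]; lra.
- by move=> /witness0_bounds[_ _ a1 a2] /(witness4_bounds n3 jn)[_ _ /andP[b1 b2] _]; lra.
- by move=> /witness1_bounds[_ _ _ _ [a1 a2]] /witness2_bounds[_ _ b1 b2]; lra.
- by move=> /witness1_bounds[_ _ a1 _ _] /witness3_bounds[_ _ _ b1 _]; lra.
- by move=> /witness1_bounds[_ _ a1 _ _] /(witness4_bounds n3 jn)[_ _ _ /andP[b1 b2]]; lra.
- by move=> /witness2_bounds[_ _ a1 a2] /witness3_bounds[_ _ _ _ [b1 b2]]; lra.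
- by move=> /witness2_bounds[_ _ a1 a2] /(witness4_bounds n3 jn)[_ _ /andP[b1 b2] _]; lra.
- by move=> /witness3_bounds[_ _ _ a1 _] /(witness4_bounds n3 jn)[_ _ _ /andP[b1 b2]]; lra.
have in' : (i.+4 < n)%N := ltn_trans ij jn.
move=> /(witness4_bounds n3 in')[_ a _ _] /(witness4_bounds n3 jn)[b _ _ _].
have e0 : 0 < (10 * n%:R)^-1 :> R by rewrite invr_gt0 mulr_gt0 ?ltr0n// (ltn_trans _ n3).
(* The centres of two discs are at least [3 * e] apart, more than the sum [2 * e] of the radii. *)
have h : i.+4%:R + 1 <= j.+4%:R :> R by rewrite natr1 ler_nat.
move: a b e0 h; rewrite -!(mulrA 3); set e := (10 * _)^-1.
move: e i.+4%:R j.+4%:R => e u v a b e0 h.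
have := ler_wpM2l (ltW e0) h; rewrite (mulrDr e u) mulr1; lra.
Qed.

Lemma witness_system (R : realType) (n : nat) : (3 < n)%N ->
  convex_system (fun i : 'I_n => @witness R n i).
Proof.
move=> n3; have n0 : (0 < n)%N by exact: ltn_trans n3.
split; first by split => //; exact: ltn_trans n3.
- move=> i j _ _ ij0; apply/val_inj/eqP; move: ij0; apply: contraPT.
  rewrite neq_ltn => /orP[ij|ji].
    by rewrite (witness_disjoint R n3 (ltn_ord j) ij) => -[].
  by rewrite setIC (witness_disjoint R n3 (ltn_ord i) ji) => -[].
- by move=> i; have [] := witness_body R i n0.
- by move=> i; have [] := witness_body R i n0.
- by move=> i; have [] := witness_body R i n0.
Qed.

Lemma witness_no_ordinary (R : realType) (n : nat) : (3 < n)%N ->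
  ~ has_ordinary (\bigcup_(i in [set: 'I_n]) @witness R n i).
Proof.
move=> n3; have n0 : (0 < n)%N by exact: ltn_trans n3.
have sK k : strictly_convex (@witness R n k) by have [] := witness_body R k n0.
have sub k : (k < n)%N ->
    @witness R n k `<=` \bigcup_(i in [set: 'I_n]) @witness R n i.
  by move=> kn x Wx; exists (Ordinal kn).
have l0 : (0 < n)%N by []. have l1 : (1 < n)%N by exact: ltn_trans n3.
have l2 : (2 < n)%N by exact: ltn_trans n3.
(* The twelve frame points are endpoints of the axes of the four ellipses. *)
apply: (no_ordinary_of_frame (sK 0) (sK 1) (sK 2) (sK 3)
  (sub 0 l0) (sub 1 l1) (sub 2 l2) (sub 3 n3));
  try by rewrite /witness /ellipse /= !mxE /=; lra.
- move=> x [[i ilt] _ /=]; case: i ilt => [|[|[|[|i]]]] ilt.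
  + by move=> /witness0_bounds[a b _ _]; rewrite a b.
  + by move=> /witness1_bounds[_ _ a b _]; rewrite b andbT; lra.
  + by move=> /witness2_bounds[a b _ _]; rewrite a b.
  + by move=> /witness3_bounds[_ _ a b _]; rewrite a; lra.
  + by move=> /(witness4_bounds n3 ilt)[_ _ _ /andP[a b]]; apply/andP; split; lra.
- move=> x [[i ilt] _ /=]; case: i ilt => [|[|[|[|i]]]] ilt //.
  + by move=> /witness1_bounds[].
  + by move=> /witness2_bounds[a b c d] _; lra.
  + by move=> /witness3_bounds[].
  + by move=> /(witness4_bounds n3 ilt)[_ _ /andP[a b] _] _; lra.
- move=> x [[i ilt] _ /=]; case: i ilt => [|[|[|[|i]]]] ilt //.
  + by move=> /witness0_bounds[a b c d] _; lra.
  + by move=> /witness1_bounds[].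
  + by move=> /witness3_bounds[].
  + by move=> /(witness4_bounds n3 ilt)[_ _ /andP[a b] _] _; lra.
Qed.

(** * The equivalence *)

Lemma convex_system_ordinary (R : realType) (n : nat) (K : 'I_n -> set 'rV[R]_2) :
  (n <= 3)%N -> convex_system K -> has_ordinary (\bigcup_i K i).
Proof.
move=> n3 [[_ n2] tK cK sK iK].
have bK i : body (K i) by split.
have dK i j : i != j -> K i `&` K j = set0.
  move=> ij; apply/eqP/negPn/negP => /set0P KK.
  by move/eqP: ij; apply; exact: tK.
case: n n3 n2 K {tK cK sK iK} bK dK => [|[|[|[|n]]]] // _ _ K bK dK.
- have -> : \bigcup_i K i = K 0 `|` K 1.
    apply/seteqP; split => [x [[[|[|//]] ik] _ Kx]|x [Kx|Kx]].
    + by left; congr (K _ _): Kx; exact: val_inj.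
    + by right; congr (K _ _): Kx; exact: val_inj.
    + by exists 0.
    + by exists 1.
  by apply: ordinary_two => //; exact: dK.
- have -> : \bigcup_i K i = K 0 `|` K 1 `|` K 2.
    apply/seteqP; split => [x [[[|[|[|//]]] ik] _ Kx]|x [[Kx|Kx]|Kx]].
    + by left; left; congr (K _ _): Kx; exact: val_inj.
    + by left; right; congr (K _ _): Kx; exact: val_inj.
    + by right; congr (K _ _): Kx; exact: val_inj.
    + by exists 0.
    + by exists 1.
    + by exists 2.
  by apply: ordinary_three => //; exact: dK.
Qed.

Theorem theorem4 (R : realType) (n : nat) (hn : (2 <= n)%N) :
  (exists K : 'I_n -> set 'rV[R]_2,
     convex_system K /\ ~ (exists L : set 'rV[R]_2, ordinary_line K L))
  <-> (3 < n)%N.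
Proof.
split=> [[K [sysK noK]]|n3].
  rewrite ltnNge; apply/negP => n3; apply: noK.
  exact: (convex_system_ordinary n3 sysK).
exists (fun i : 'I_n => @witness R n i); split; first exact: witness_system.
exact: witness_no_ordinary.
Qed.
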